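(* Let $G$ be a finite group. Then the following statements are pairwise equivalent: (1) For every normal subgroup $N$ of $G$, $\Phi(G/N)=\Phi(G)N/N$. (2) $G/\Phi(G)$ has no Frattini chief factors. (3) $G/F(G)$ has no Frattini chief factors. (4) $G/F'(G)$ has no Frattini chief factors. (5) For every chief factor $H/K$ of $G$, the group $G/C_G(H/K)$ has no Frattini chief factors.
   Context: All groups are finite. $\Phi(G)$ is the Frattini subgroup and $F(G)$ the Fitting subgroup of $G$. $F'(G)$ denotes the normal subgroup of $G$ containing $\Phi(G)$ such that $F'(G)/\Phi(G)=\operatorname{Soc}(G/\Phi(G))$, where $\operatorname{Soc}$ is the socle (the product of all minimal normal subgroups). A chief factor of a group $X$ is a quotient $H/K$ with $H,K$ normal in $X$ and $H/K$ a minimal normal subgroup of $X/K$; it is Frattini if $H/K\leq\Phi(X/K)$. $C_G(H/K)$ is the kernel of the conjugation action of $G$ on $H/K$. *)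

(* Defs.v *)
From mathcomp Require Import all_boot all_fingroup all_solvable.

Set Implicit Arguments.
Unset Strict Implicit.
Unset Printing Implicit Defensive.

Local Open Scope group_scope.

Section Defs.

Variable gT : finGroupType.
Implicit Types (A : {set gT}) (G H K M : {group gT}).

(* Beware of the argument order: [chief_factor A K H] is about H / K.  See    *)
(* chief_factorE below for the usual description when A is a group.           *)
Definition Frattini_chief_factor A K H :=
  chief_factor A K H && (H / K \subset 'Phi(A / K)).

Definition no_Frattini_chief_factor A : Prop :=
  forall K H, ~~ Frattini_chief_factor A K H.

(* [minnormal M A] does not require M \subset A, hence the conjunct M <| A.   *)
Definition Socle A : {group gT} :=
  (\prod_(M : {group gT} | (M <| A) && minnormal M A) M)%G.

End Defs.

Notation "''Soc' ( A )" := (Socle A) (format "''Soc' ( A )") : group_scope.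

Definition Fitting_prime (gT : finGroupType) (G : {group gT}) : {set gT} :=
  coset 'Phi(G) @*^-1 'Soc(G / 'Phi(G)).

Notation "''Fprime' ( G )" := (Fitting_prime G)
  (format "''Fprime' ( G )") : group_scope.

Section Facts.

Variable gT : finGroupType.
Implicit Types G H K : {group gT}.

Lemma chief_factorE G K H :
  chief_factor G K H =
    [&& K \subset H, K <| G, H <| G & minnormal (H / K) (G / K)].
Proof.
apply/idP/and4P => [chKH | [sKH nsKG nsHG minHK]].
  have /andP[/maxgroupP[/andP[/proper_sub sKH nKG] _] nsHG] := chKH.
  split=> //; last exact: chief_factor_minnormal.
  by rewrite /normal nKG (subset_trans sKH) ?normal_sub.
rewrite /chief_factor nsHG andbT.
by rewrite minnormal_maxnormal ?normal_norm // (normalS sKH (normal_sub nsHG)).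
Qed.

Lemma Socle_normal G : 'Soc(G) <| G.
Proof.
rewrite /Socle /=.
elim/big_rec: _ => [|M N /andP[nsMG _] nsNG]; first exact: normal1.
exact: normalY.
Qed.

End Facts.

Section FittingPrimeFacts.

Variables (gT : finGroupType) (G : {group gT}).

Lemma Phi_sub_Fitting_prime : 'Phi(G) \subset 'Fprime(G).
Proof. exact: sub_cosetpre. Qed.

Lemma Fitting_prime_normal : 'Fprime(G) <| G.
Proof.
rewrite -[X in _ <| X](quotientGK (Phi_normal G)) cosetpre_normal.
exact: Socle_normal.
Qed.

Lemma quotient_Fitting_prime : 'Fprime(G) / 'Phi(G) = 'Soc(G / 'Phi(G)).
Proof. exact: cosetpreK. Qed.

End FittingPrimeFacts.

(* Main.v *)
Require Import Defs.
From mathcomp Require Import all_boot all_fingroup all_solvable.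

(* Say that a normal subgroup A of G is good if every quotient of G/A has      *)
(* trivial Frattini subgroup, i.e., G/A has no Frattini chief factors.  As in  *)
(* the strengthened Jordan-Hoelder theorem, if B/A is a non-Frattini chief     *)
(* factor of G and B is good, then so is A; hence goodness descends along any  *)
(* chief series without Frattini factors.  In X = G/Phi(G) this applies        *)
(* between F(X) and 1, because abelian normal subgroups of X are complemented  *)
(* (Gaschuetz), and between Soc(X) and F(X), because an abelian chief factor   *)
(* H/K with F(X) <= K < H <= Soc(X) cannot exist: Soc(X) <= K C_X(H) would     *)
(* give H <= K Z(H) = K.  It also shows that good subgroups are closed under   *)
(* intersection, and the centralisers of the chief factors of G meet in a      *)
(* nilpotent group containing F(G), that is, in F(G).                          *)

(** Statements (2) to (5) say that ['Phi(G)], ['F(G)], ['Fprime(G)] and all centralisers of chief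
    factors are good; (1) is again goodness of ['Phi(G)]. Goodness passes to larger normal
    subgroups, and Phi(G) <= F(G) <= F'(G), F(G) <= C_G(H/K), so the content lies in the descents:
    from Soc(X) to F(X) to 1 in X = G/Phi(G) ([Frattini_free_over_Socle], [Frattini_free_over1]),
    and from the centralisers to F(G) ([Frattini_free_over_Fitting]). All rest on
    [Frattini_free_over_chief_factor]. *)

Set Implicit Arguments.
Unset Strict Implicit.
Unset Printing Implicit Defensive.

Local Open Scope group_scope.

(* H / K \subset 'Phi(G / K) (Frattini_over_quo), stated inside G so that no   *)
(* iterated quotients occur.                                                  *)
Definition Frattini_over (gT : finGroupType) (G K H : {group gT}) : bool :=
  [forall M : {group gT}, maximal M G && (K \subset M) ==> (H \subset M)].

(** Goodness of [A]. As [H] need not contain [K], the premise on [H] means HK/K <= Phi(G/K). *)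
Definition Frattini_free_over (gT : finGroupType) (G A : {group gT}) : Prop :=
  forall K H : {group gT}, K <| G -> H <| G -> A \subset K ->
    Frattini_over G K H -> H \subset K.

(** * Frattini sections and goodness under quotients *)

Lemma Frattini_overP (gT : finGroupType) (G K H : {group gT}) :
  reflect (forall M : {group gT}, maximal M G -> K \subset M -> H \subset M)
          (Frattini_over G K H).
Proof.
apply: (iffP forallP) => [FH M maxM sKM | FH M].
  by have := FH M; rewrite maxM sKM.
by apply/implyP=> /andP[maxM sKM]; apply: FH.
Qed.

Lemma Frattini_overPn (gT : finGroupType) (G K H : {group gT}) :
  reflect (exists M : {group gT}, [/\ maximal M G, K \subset M & ~~ (H \subset M)])
          (~~ Frattini_over G K H).
Proof.
rewrite /Frattini_over negb_forall; apply: (iffP existsP) => [[M] | [M [mM sKM nsHM]]].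
  by rewrite negb_imply => /andP[/andP[mM sKM] nsHM]; exists M.
by exists M; rewrite negb_imply mM sKM.
Qed.

Lemma Frattini_overS (gT : finGroupType) (G K1 K2 H1 H2 : {group gT}) :
  K1 \subset K2 -> H2 \subset H1 -> Frattini_over G K1 H1 -> Frattini_over G K2 H2.
Proof.
move=> sK sH /Frattini_overP FH; apply/Frattini_overP=> M mM sKM.
exact: subset_trans sH (FH M mM (subset_trans sK sKM)).
Qed.

Lemma Frattini_overY (gT : finGroupType) (G K H : {group gT}) :
  Frattini_over G K (K <*> H)%G = Frattini_over G K H.
Proof.
apply/Frattini_overP/Frattini_overP => FH M mM sKM.
  by apply: subset_trans (FH M mM sKM); apply: joing_subr.
by rewrite join_subG sKM FH.
Qed.

Lemma mul_normal_maximal (gT : finGroupType) (G N M : {group gT}) :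
  N <| G -> maximal M G -> ~~ (N \subset M) -> N * M = G.
Proof.
move=> nsNG mM nsNM; have /andP[sNG nNG] := nsNG.
have sMG := proper_sub (maxgroupp mM).
have nNM := subset_trans sMG nNG.
have [_ maxM] := maxgroupP mM.
rewrite -norm_joinEr //; apply/eqP; rewrite eqEproper join_subG sNG sMG /=.
apply: contra nsNM => prNM; rewrite -(maxM (N <*> M)%G) ?joing_subr ?joing_subl //.
Qed.

Lemma Frattini_over_quo (gT : finGroupType) (G K H : {group gT}) :
  K <| G -> H <| G -> Frattini_over G K H = (H / K \subset 'Phi(G / K)).
Proof.
move=> nsKG nsHG; have nKH := subset_trans (normal_sub nsHG) (normal_norm nsKG).
apply/Frattini_overP/idP => [FH | sHPhi M mM sKM].
  apply/bigcapsP=> Mb /predU1P[->|mMb]; first by rewrite quotientS ?normal_sub.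
  rewrite sub_quotient_pre //.
  by apply: (FH (coset K @*^-1 Mb)%G); rewrite ?sub_cosetpre // -(quotientGK nsKG) cosetpre_maximal.
have sMG := proper_sub (maxgroupp mM).
have nKM := subset_trans sMG (normal_norm nsKG).
have nsKM : K <| M by apply/andP.
rewrite -(quotientSGK nKH sKM).
by apply: subset_trans sHPhi (Phi_sub_max _); rewrite quotient_maximal.
Qed.

Lemma Frattini_over_cosetpre (gT : finGroupType) (G A : {group gT})
    (K H : {group coset_of A}) :
  A <| G ->
  Frattini_over (G / A)%G K H
    = Frattini_over G (coset A @*^-1 K)%G (coset A @*^-1 H)%G.
Proof.
move=> nsAG; apply/Frattini_overP/Frattini_overP => FH M mM sKM.
  have sAM : A \subset M by apply: subset_trans sKM; apply: sub_cosetpre.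
  have sMG := proper_sub (maxgroupp mM).
  have nKM := subset_trans sMG (normal_norm nsAG).
  have nsAM : A <| M by apply/andP.
  rewrite -(quotientGK nsAM) cosetpreSK; apply: FH; rewrite ?quotient_maximal //.
  by rewrite -cosetpreSK quotientGK.
rewrite -cosetpreSK; apply: (FH (coset A @*^-1 M)%G); last by rewrite cosetpreSK.
by rewrite -(quotientGK nsAG) cosetpre_maximal.
Qed.

Lemma Frattini_free_over_cosetpre (gT : finGroupType) (G A : {group gT})
    (B : {group coset_of A}) :
  A <| G ->
  Frattini_free_over (G / A)%G B <-> Frattini_free_over G (coset A @*^-1 B)%G.
Proof.
move=> nsAG; split=> FF K H nsKG nsHG sBK FKH.
  have sAK : A \subset K by apply: subset_trans sBK; apply: sub_cosetpre.
  have nsAK := normalS sAK (normal_sub nsKG) nsAG.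
  (* [H] need not contain [A]; [K <*> H] does, and has the same image modulo [K]. *)
  have nsAKH : A <| (K <*> H)%G.
    by apply: normalS nsAG; rewrite ?(subset_trans sAK) ?joing_subl // join_subG !normal_sub.
  suff: K <*> H \subset K by rewrite join_subG => /andP[].
  rewrite -(quotientSGK _ sAK) ?normal_norm //.
  apply: (FF (K / A)%G (K <*> H / A)%G); rewrite ?quotient_normal //.
  - exact: normalY.
  - by rewrite -cosetpreSK quotientGK.
  rewrite Frattini_over_cosetpre //.
  by apply: Frattini_overS (_ : Frattini_over G K (K <*> H)%G); rewrite ?Frattini_overY //= quotientGK.
rewrite -cosetpreSK; apply: (FF (coset A @*^-1 K)%G (coset A @*^-1 H)%G).
- by rewrite -(quotientGK nsAG) cosetpre_normal.
- by rewrite -(quotientGK nsAG) cosetpre_normal.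
- by rewrite cosetpreSK.
by rewrite -Frattini_over_cosetpre.
Qed.

(** * Chief factors *)

Lemma ex_chief_factor (gT : finGroupType) (G A B : {group gT}) :
  A <| G -> B <| G -> A \proper B ->
  exists2 K : {group gT}, A \subset K & chief_factor G K B.
Proof.
move=> nsAG nsBG prAB.
have [|K mK sAK] := @maxgroup_exists _ (fun H : {group gT} => (H \proper B) && (G \subset 'N(H))) A.
  by rewrite prAB normal_norm.
by exists K => //; rewrite /chief_factor nsBG andbT.
Qed.

Lemma chief_factor_mid (gT : finGroupType) (G K H L : {group gT}) :
  chief_factor G K H -> L <| G -> K \subset L -> L \subset H ->
  L :=: K \/ L :=: H.
Proof.
case/andP=> /maxgroupP[_ maxK] nsHG nsLG sKL sLH.
have [->|neLH] := eqVneq (L : {set gT}) H; [by right | left].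
by apply: maxK; rewrite // properEneq neLH sLH normal_norm.
Qed.

Lemma chief_factor_normal (gT : finGroupType) (G K H : {group gT}) :
  chief_factor G K H -> [/\ K <| G, H <| G & K \proper H].
Proof.
case/andP=> /maxgroupp/andP[prKH nKG] nsHG; split=> //.
by rewrite /normal nKG (subset_trans (proper_sub prKH)) ?normal_sub.
Qed.

Lemma Frattini_free_overS (gT : finGroupType) (G A B : {group gT}) :
  A \subset B -> Frattini_free_over G A -> Frattini_free_over G B.
Proof.
by move=> sAB FF K H nsK nsH sBK; apply: FF => //; apply: subset_trans sBK.
Qed.

Lemma no_Frattini_chief_factorP (gT : finGroupType) (G : {group gT}) :
  no_Frattini_chief_factor G <-> Frattini_free_over G 1%G.
Proof.
split=> [nF K H nsKG nsHG _ FKH | FF K H].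
  suff: K <*> H \subset K by rewrite join_subG => /andP[].
  apply: contraT => nsHK.
  have [|L sKL chL] := @ex_chief_factor _ G K (K <*> H)%G nsKG (normalY nsKG nsHG).
    by rewrite properE joing_subl.
  have [nsLG nsYG _] := chief_factor_normal chL.
  have /negP[] := nF L (K <*> H)%G; rewrite /Frattini_chief_factor chL /=.
  rewrite -Frattini_over_quo //.
  by apply: Frattini_overS (_ : Frattini_over G K (K <*> H)%G); rewrite ?Frattini_overY.
apply/negP=> /andP[chF FKH].
have [nsKG nsHG /andP[_ /negP[]]] := chief_factor_normal chF.
by apply: FF; rewrite ?sub1G // Frattini_over_quo.
Qed.

Lemma no_Frattini_chief_factor_quo (gT : finGroupType) (G A : {group gT}) :
  A <| G -> no_Frattini_chief_factor (G / A) <-> Frattini_free_over G A.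
Proof.
move=> nsAG; apply: iff_trans (no_Frattini_chief_factorP _) _.
apply: iff_trans (Frattini_free_over_cosetpre _ nsAG) _.
by split; apply: Frattini_free_overS; rewrite /= -kerE ker_coset.
Qed.

(** Frattini argument: for a Sylow subgroup P of L, Phi(G)P is normal in G, as the preimage of a
    Sylow subgroup of the nilpotent L/Phi(G). So G = Phi(G) N_G(P), whence P is normal in G. *)
Lemma nilpotent_quo_Phi (gT : finGroupType) (G L : {group gT}) :
  L <| G -> 'Phi(G) \subset L -> nilpotent (L / 'Phi(G)) -> nilpotent L.
Proof.
move=> nsLG sPhL nilQ; have [sLG nLG] := andP nsLG.
have nPhL : L \subset 'N('Phi(G)) := subset_trans sLG (normal_norm (Phi_normal G)).
apply: nilpotentS (Fitting_nil L); rewrite -{1}(Sylow_gen L) gen_subG.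
apply/bigcupsP=> P /SylowP[p _ sylP]; have sPL := pHall_sub sylP.
apply: Fitting_max (pgroup_nil (pHall_pgroup sylP)).
have nPhP := subset_trans sPL nPhL.
pose Q := ('Phi(G) <*> P)%G.
have sQL : Q \subset L by rewrite join_subG sPhL.
have nsQG : Q <| G.
  rewrite -(quotientGK (Phi_normal G)) -(quotientGK (_ : 'Phi(G) <| Q)); last first.
    by rewrite /normal joing_subl join_subG normG.
  rewrite cosetpre_normal quotientYidl //.
  rewrite (nilpotent_Hall_pcore nilQ (quotient_pHall nPhP sylP)).
  by apply: gFnormal_trans; apply: quotient_normal.
have sylQ : p.-Sylow(Q) P := pHall_subl (joing_subr _ _) sQL sylP.
have defG := Frattini_arg nsQG sylQ.
suff nPG : 'N_G(P) = G by rewrite /normal sPL (subset_trans sLG) // -nPG subsetIr.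
rewrite -{2}(Phi_nongen (X := 'N_G(P))) ?genGid //.
apply/eqP; rewrite eqEsubset join_subG Phi_sub subsetIl /= -{1}defG.
rewrite mulG_subG joing_subr andbT join_subG joing_subl /=.
by rewrite (subset_trans _ (joing_subr _ _)) // subsetI (subset_trans sPL sLG) normG.
Qed.

Lemma Phi_nilpotent (gT : finGroupType) (G : {group gT}) : nilpotent 'Phi(G).
Proof.
apply: nilpotent_quo_Phi (Phi_normal G) _ _ => //.
by rewrite trivg_quotient nilpotent1.
Qed.

(* B / A is either abelian or perfect, and B / N, a quotient of it, is         *)
(* nilpotent.                                                                 *)
Lemma chief_factor_der1 (gT : finGroupType) (G A B N : {group gT}) :
  chief_factor G A B -> N <| G -> A \subset N -> ~~ (B \subset N) ->
  Frattini_over G N B -> [~: B, B] \subset A.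
Proof.
move=> chB nsNG sAN nsBN FB; have [nsAG nsBG prAB] := chief_factor_normal chB.
have nNB := subset_trans (normal_sub nsBG) (normal_norm nsNG).
have sBB : [~: B, B] \subset B := der_sub 1 B.
have sYB : A <*> [~: B, B] \subset B by rewrite join_subG (proper_sub prAB) sBB.
have [||<-|eqB] := chief_factor_mid (L := (A <*> [~: B, B])%G) chB _ _ sYB; rewrite ?joing_subl ?joing_subr //.
  exact: normalY nsAG (char_normal_trans (der_char 1 B) nsBG).
have solB : solvable (B / N).
  apply: nilpotent_sol; apply: nilpotentS (Phi_nilpotent (G / N)).
  by rewrite -Frattini_over_quo.
have ntB : B / N != 1 by rewrite -subG1 quotient_sub1.
have /andP[_ /negP[]] := sol_der1_proper solB (subxx _) ntB.
rewrite derg1 -quotientR // quotientSK // -{1}eqB.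
rewrite -norm_joinEr ?(subset_trans sBB) // join_subG joing_subr andbT.
by apply: subset_trans sAN _; apply: joing_subl.
Qed.

(** * Descent of goodness *)

(** Let RN/N <= Phi(G/N) with A <= N but R not inside N. Goodness of B traps R in NB; then B <= NR,
    so B is Frattini over N and B/A is abelian, with a maximal complement M/A in G/A. Playing M
    against a second maximal subgroup X, which contains B but not N, gives the contradiction. *)
Lemma Frattini_free_over_chief_factor (gT : finGroupType) (G A B : {group gT}) :
  chief_factor G A B -> ~~ Frattini_over G A B -> Frattini_free_over G B ->
  Frattini_free_over G A.
Proof.
move=> chB nFB FF N R nsNG nsRG sAN FR.
have [nsAG nsBG prAB] := chief_factor_normal chB; have sAB := proper_sub prAB.
apply: contraT => nsRN.
have [nsNB sNNB] := (normalY nsNG nsBG, joing_subl N B).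
have sRNB : R \subset N <*> B.
  apply: (FF (N <*> B)%G) => //; first exact: joing_subr.
  exact: Frattini_overS sNNB (subxx _) FR.
have nNB : B \subset 'N(N) := subset_trans (normal_sub nsBG) (normal_norm nsNG).
have nsBN : ~~ (B \subset N).
  by apply: contra nsRN => sBN; apply: subset_trans sRNB _; rewrite join_subG subxx.
have sBNR : B \subset N <*> R.
  have sABNR : A \subset B :&: (N <*> R).
    by rewrite subsetI sAB (subset_trans sAN) ?joing_subl.
  have [|eqA|<-] := chief_factor_mid chB _ sABNR (subsetIl _ _).
  - by apply: normalI (normalY nsNG nsRG).
  - case/negP: nsRN; have: N <*> R \subset N * B :&: (N <*> R).
      by rewrite subsetI subxx -norm_joinEr // join_subG sNNB sRNB.
    rewrite -group_modl ?joing_subl // eqA mulGSid // join_subG.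
    by case/andP.
  exact: subsetIr.
have FB : Frattini_over G N B.
  by apply: Frattini_overS (subxx N) sBNR _; rewrite Frattini_overY.
have abB := chief_factor_der1 chB nsNG sAN nsBN FB.
have [M [mM sAM nsBM]] := Frattini_overPn _ _ _ nFB.
have proper_max (Z : {group gT}) : maximal Z G -> ~~ (G \subset Z).
  by move=> mZ; have /andP[] := maxgroupp mZ.
have sMG := proper_sub (maxgroupp mM).
have defG := mul_normal_maximal nsBG mM nsBM.
have nBM : M \subset 'N(B) := subset_trans sMG (normal_norm nsBG).
have nNM : M \subset 'N(N) := subset_trans sMG (normal_norm nsNG).
(* Commutativity of [B / A] makes [B] normalise [B :&: M], as [M] does already. *)
have eqBM : B :&: M = A.
  have [||//|eqBM] := chief_factor_mid (L := (B :&: M)%G) chB _ _ (subsetIl B M).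
  - rewrite /normal subIset ?(normal_sub nsBG) //= -defG mulG_subG andbC normsI //=.
    rewrite -commg_subl; apply: subset_trans (_ : A \subset _).
      by apply: subset_trans abB; rewrite commgSS ?subsetIl.
    by rewrite subsetI sAB.
  - by rewrite subsetI sAB.
  by case/negP: nsBM; rewrite -eqBM subsetIr.
have eqNB : N :&: B = A.
  have [||//|eqNB] := chief_factor_mid (L := (N :&: B)%G) chB _ _ (subsetIr N B).
  - exact: normalI.
  - by rewrite subsetI sAN.
  by case/negP: nsBN; rewrite -eqNB subsetIl.
have nsNM : ~~ (N \subset M) by apply: contra nsBM; apply/Frattini_overP: mM.
have defGN := mul_normal_maximal nsNG mM nsNM.
(* [K] meets [N] exactly in [N :&: M], so it misses part of [N]; since it contains the good [B],
   some maximal subgroup over [K] does not contain [N]. *)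
pose K := ((N :&: M) <*> B)%G.
have nBNM : N :&: M \subset 'N(B) by rewrite subIset ?nBM ?orbT.
have nsKG : K <| G.
  rewrite /normal /K /= join_subG subIset ?(normal_sub nsNG) ?(normal_sub nsBG) //=.
  rewrite -defG mulG_subG (subset_trans (joing_subr _ _) (normG _)) /=.
  by rewrite normsY // normsI ?normG.
have nsNK : ~~ (N \subset K).
  apply: contra nsNM; rewrite /K /= norm_joinEl // => sNK.
  rewrite -(setIidPr sNK) -group_modl ?subsetIl // (setIC B) eqNB.
  by rewrite mul_subG ?subsetIr.
have /Frattini_overPn[X [mX sKX nsNX]] : ~~ Frattini_over G K N.
  by apply: contra nsNK; apply: FF => //; apply: joing_subr.
have [sNMX sBX] : N :&: M \subset X /\ B \subset X by apply/andP; rewrite -join_subG.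
have sXG := proper_sub (maxgroupp mX).
have defGX := mul_normal_maximal nsNG mX nsNX.
have nNXM : X :&: M \subset 'N(N) by rewrite subIset ?nNM ?orbT.
have sLG : N <*> (X :&: M) \subset G by rewrite join_subG normal_sub // subIset ?sXG.
(* N (X :&: M) is a proper subgroup by Dedekind, but together with B it        *)
(* generates G, against FB.                                                   *)
have [eqG | [Y mY]] := maximal_exists sLG.
  case/negP: (proper_max X mX); rewrite -defG mul_subG //.
  have: M \subset N * (X :&: M) by rewrite -norm_joinEr // eqG.
  move/setIidPl <-; rewrite -group_modr ?subsetIr //.
  by rewrite mul_subG ?subsetIl // setIC.
rewrite join_subG => /andP[sNY sXMY].
case/negP: (proper_max Y mY); rewrite -defGX mul_subG //.
have sBY : B \subset Y by apply: (Frattini_overP _ _ _ FB).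
have: X \subset B * M by rewrite defG.
by move/setIidPl <-; rewrite setIC -group_modl // mul_subG // setIC.
Qed.

Lemma Frattini_free_over_descend (gT : finGroupType) (G A B : {group gT}) :
  A <| G -> B <| G -> A \subset B -> Frattini_free_over G B ->
  (forall K H : {group gT}, chief_factor G K H -> A \subset K -> H \subset B ->
     ~~ Frattini_over G K H) ->
  Frattini_free_over G A.
Proof.
move=> nsAG; have [n] := ubnP #|B|; elim: n B => // n IHn B.
rewrite ltnS => leBn nsBG sAB FFB nF.
have [eqAB | neAB] := eqVneq (A : {set gT}) B.
  by apply: Frattini_free_overS FFB; rewrite eqAB.
have [|K sAK chB] := ex_chief_factor nsAG nsBG _; first by rewrite properEneq neAB.
have [nsKG _ prKB] := chief_factor_normal chB.
apply: (IHn K) => //; first exact: leq_trans (proper_card prKB) leBn.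
  by apply: Frattini_free_over_chief_factor FFB => //; apply: nF.
by move=> L H chH sAL sHK; apply: nF => //; apply: subset_trans (proper_sub prKB).
Qed.

(** Descend from A. If A :&: B <= K < H <= A and H is Frattini over K, goodness of B gives H <= KB,
    and Dedekind's law gives H = K(B :&: H) <= K. *)
Lemma Frattini_free_overI (gT : finGroupType) (G A B : {group gT}) :
  A <| G -> B <| G -> Frattini_free_over G A -> Frattini_free_over G B ->
  Frattini_free_over G (A :&: B)%G.
Proof.
move=> nsAG nsBG FFA FFB.
apply: (Frattini_free_over_descend (normalI nsAG nsBG) nsAG _ FFA).
  exact: subsetIl.
move=> K H chH sIK sHA; have [nsKG nsHG /andP[sKH nsHK]] := chief_factor_normal chH.
apply: contra nsHK => FH.
have nKB : B \subset 'N(K) := subset_trans (normal_sub nsBG) (normal_norm nsKG).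
have sHKB : H \subset K <*> B.
  apply: (FFB (K <*> B)%G); rewrite ?joing_subr //; first exact: normalY.
  exact: Frattini_overS (joing_subl _ _) (subxx _) FH.
move: sHKB; rewrite norm_joinEr // => /setIidPr <-.
rewrite -group_modl // mul_subG //.
by apply: subset_trans sIK; rewrite setIC setSI.
Qed.

(** * Centralisers of chief factors *)

(** If H/K meets the nilpotent normal subgroup F(G)K/K nontrivially, it meets its centre, which is
    normal in G/K, so by minimality lies in it. Otherwise the two commute. *)
Lemma Fitting_centralises_chief_factor (gT : finGroupType) (G K H : {group gT}) :
  chief_factor G K H -> 'F(G) \subset 'C_G(H / K | 'Q).
Proof.
move=> chH; have [nsKG nsHG /andP[sKH nsHK]] := chief_factor_normal chH.
have nKH := subset_trans (normal_sub nsHG) (normal_norm nsKG).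
have nKF := subset_trans (Fitting_sub G) (normal_norm nsKG).
rewrite subsetI Fitting_sub astabQ -sub_quotient_pre //.
have nilF : nilpotent ('F(G) / K) := quotient_nil _ (Fitting_nil G).
have nsFG : 'F(G) / K <| G / K := quotient_normal _ (Fitting_normal G).
have nsHQ : H / K <| G / K := quotient_normal _ nsHG.
have minH := chief_factor_minnormal chH.
have [ntH _] := andP (mingroupp minH).
have [tiFH | ntI] := eqVneq (H / K :&: 'F(G) / K) 1.
  rewrite centsC; apply/commG1P/trivgP; rewrite -tiFH commg_subI //.
    by rewrite subsetI subxx (subset_trans (normal_sub nsHQ)) ?normal_norm.
  by rewrite subsetI subxx (subset_trans (normal_sub nsFG)) ?normal_norm.
have ntZ : (H / K :&: 'F(G) / K) :&: 'Z('F(G) / K) != 1.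
  apply: meet_center_nil => //; rewrite /normal subsetIr.
  by rewrite normsI ?normG // (subset_trans (normal_sub nsFG)) ?normal_norm.
have nsI : (H / K :&: 'F(G) / K) :&: 'Z('F(G) / K) <| G / K.
  exact: normalI (normalI nsHQ nsFG) (char_normal_trans (center_char _) nsFG).
have [_ minH'] := mingroupP minH.
have := minH' ((H / K :&: 'F(G) / K) :&: 'Z('F(G) / K))%G.
rewrite /= ntZ normal_norm // -setIA subsetIl => /(_ isT isT) /setIidPl sHZ.
rewrite centsC; apply: subset_trans sHZ _.
exact: subset_trans (subsetIr _ _) (subsetIr _ _).
Qed.

Lemma subcent_chief_factor_normal (gT : finGroupType) (G K H : {group gT}) :
  chief_factor G K H -> 'C_G(H / K | 'Q) <| G.
Proof.
case/chief_factor_normal=> nsKG nsHG _.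
rewrite astabQ -(quotientGK nsKG) -morphpreI cosetpre_normal.
by rewrite norm_normalI // norms_cent // normal_norm // quotient_normal.
Qed.

(** D is the intersection of the centralisers along one chief series below H; each factor adds one
    step to the upper central series. Quantifying over all E inside D lets the induction shrink D.
    For H = G, taking E = D makes D nilpotent. *)
Lemma ex_nilpotent_stabiliser (gT : finGroupType) (G H : {group gT}) :
  (forall U V : {group gT}, chief_factor G V U ->
     Frattini_free_over G 'C_G(U / V | 'Q)%G) ->
  H <| G ->
  exists2 D : {group gT}, D <| G /\ Frattini_free_over G D
    & exists n, forall E : {group gT}, E \subset D -> E :&: H \subset 'Z_n(E).
Proof.
move=> FC; have [m] := ubnP #|H|; elim: m H => // m IHm H.
rewrite ltnS => leHm nsHG; have [-> | ntH] := eqsVneq H 1%G.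
  exists G; first by split; [exact: normal_refl | move=> K L _ /andP[sLG _] /(subset_trans sLG)].
  by exists 0%N => E _; rewrite ucn0 subsetIr.
have [|K _ chH] := ex_chief_factor (normal1 G) nsHG _; first by rewrite proper1G.
have [nsKG _ prKH] := chief_factor_normal chH.
have [D [nsDG FD] [n ZD]] := IHm K (leq_trans (proper_card prKH) leHm) nsKG.
have nsCG := subcent_chief_factor_normal chH.
exists (D :&: 'C_G(H / K | 'Q))%G.
  by split; [exact: normalI | apply: Frattini_free_overI => //; apply: FC].
exists n.+1 => E /subsetIP[sED /subsetIP[sEG sEC]].
apply/subsetP=> x /setIP[Ex Hx]; rewrite ucnSnR inE Ex /=.
apply: subset_trans (ZD E sED); rewrite subsetI; apply/andP; split.
  by apply: subset_trans (commSg _ (_ : [set x] \subset E)) (der_sub 1 E); rewrite sub1set.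
have nKE := subset_trans sEG (normal_norm nsKG).
have nKx : [set x] \subset 'N(K) by rewrite sub1set (subsetP nKE).
rewrite -quotient_cents2 // centsC.
move: sEC; rewrite /= astabQ -sub_quotient_pre // => /subset_trans; apply.
by rewrite centS ?quotientS ?sub1set.
Qed.

Lemma Frattini_free_over_Fitting (gT : finGroupType) (G : {group gT}) :
  (forall U V : {group gT}, chief_factor G V U ->
     Frattini_free_over G 'C_G(U / V | 'Q)%G) ->
  Frattini_free_over G 'F(G)%G.
Proof.
move=> FC; have [D [nsDG FD] [n ZD]] := ex_nilpotent_stabiliser FC (normal_refl G).
apply: Frattini_free_overS FD; apply: Fitting_max => //.
apply/ucnP; exists n; apply/eqP; rewrite eqEsubset ucn_sub.
by apply: subset_trans (ZD D (subxx D)); rewrite subsetI subxx normal_sub.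
Qed.

(** * Groups with trivial Frattini subgroup *)

(* Gaschuetz: a subgroup Y minimal with R Y = G is a complement, since Y :&: R
   is normal in G and lies in 'Phi(Y). *)
Lemma abelian_normal_compl (gT : finGroupType) (G R : {group gT}) :
  R <| G -> abelian R -> 'Phi(G) = 1 ->
  exists2 Y : {group gT}, R * Y = G & R :&: Y = 1.
Proof.
move=> nsRG cRR PhiG1; have [sRG nRG] := andP nsRG.
have [|Y minY _] := @mingroup_exists _ (fun Y : {group gT} => R * Y == G) G.
  by rewrite mulSGid.
have [/eqP defG minY'] := mingroupP minY.
exists Y => //; have sYG : Y \subset G by rewrite -defG mulG_subr.
have nRY := subset_trans sYG nRG.
have nsIG : R :&: Y <| G.
  rewrite /normal subIset ?sRG //= -{1}defG mulG_subG andbC normsI ?normG //=.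
  by apply: sub_abelian_norm; rewrite ?subsetIl.
(* If a maximal [X] misses [R :&: Y], then Y = (R :&: Y)(Y :&: X), so [Y :&: X] also supplements
   [R], and minimality forces Y <= X. *)
apply/trivgP; rewrite -PhiG1; apply/bigcapsP=> X /predU1P[-> | mX].
  by rewrite normal_sub.
apply: contraT => nsIX; have defX := mul_normal_maximal nsIG mX nsIX.
have sXG := proper_sub (maxgroupp mX).
have eqY : Y :&: X = Y.
  apply: minY'; last exact: subsetIl.
  have defY : (R :&: Y) * (Y :&: X) = Y.
    by rewrite [Y :&: X]setIC group_modl ?subsetIr // defX (setIidPr sYG).
  by apply/eqP; rewrite /= -[RHS]defG -{2}defY mulgA (mulGSid (subsetIl R Y)).
by case/negP: nsIX; apply: subset_trans (subsetIr R Y) (introT setIidPl eqY).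
Qed.

(** With Y a complement of R, either NY = G and R = N by Dedekind's law, or a maximal subgroup over
    NY contains N but not R. *)
Lemma abelian_normal_Frattini_over (gT : finGroupType) (G R N : {group gT}) :
  'Phi(G) = 1 -> R <| G -> abelian R -> N <| G -> N \subset R ->
  Frattini_over G N R -> R \subset N.
Proof.
move=> PhiG1 nsRG cRR nsNG sNR /Frattini_overP FR.
have [Y defG tiRY] := abelian_normal_compl nsRG cRR PhiG1.
have sYG : Y \subset G by rewrite -defG mulG_subr.
have nNY := subset_trans sYG (normal_norm nsNG).
have sNYG : N <*> Y \subset G by rewrite join_subG normal_sub.
have [eqG | [M mM]] := maximal_exists sNYG.
  have: R \subset N * Y by rewrite -norm_joinEr // eqG normal_sub.
  by move/setIidPl <-; rewrite setIC -group_modl // setIC tiRY mulg1.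
rewrite join_subG => /andP[sNM sYM].
have /andP[_ /negP[]] := maxgroupp mM.
by rewrite -defG mul_subG // FR.
Qed.

Lemma Frattini_free_over1 (gT : finGroupType) (G A : {group gT}) :
  'Phi(G) = 1 -> A <| G -> abelian A ->
  Frattini_free_over G A -> Frattini_free_over G 1%G.
Proof.
move=> PhiG1 nsAG cAA FF.
apply: (Frattini_free_over_descend (normal1 G) nsAG (sub1G A) FF) => K H chH _ sHA.
have [nsKG nsHG /andP[sKH]] := chief_factor_normal chH; apply: contra.
exact: abelian_normal_Frattini_over PhiG1 nsHG (abelianS sHA cAA) nsKG sKH.
Qed.

(** A maximal X missing N' would give N = N'(X :&: N). But X :&: N lies in a maximal subgroup L of
    N, normal by nilpotency, and N'L < N since N/L is solvable and nontrivial. *)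
Lemma nilpotent_normal_abelian (gT : finGroupType) (G N : {group gT}) :
  'Phi(G) = 1 -> N <| G -> nilpotent N -> abelian N.
Proof.
move=> PhiG1 nsNG nilN; apply/commG1P/trivgP; rewrite -PhiG1.
have nsDG : [~: N, N] <| G := char_normal_trans (der_char 1 N) nsNG.
apply/bigcapsP=> X /predU1P[-> | mX]; first exact: normal_sub.
apply: contraT => nsDX; have defG := mul_normal_maximal nsDG mX nsDX.
have sDN : [~: N, N] \subset N := der_sub 1 N.
have defN : [~: N, N] * (X :&: N) = N by rewrite group_modl //= defG (setIidPr (normal_sub nsNG)).
have [eqN | [L mL sXL]] := maximal_exists (subsetIr X N).
  by case/negP: nsDX; apply: subset_trans sDN _; rewrite -eqN subsetIl.
have prL := maxgroupp mL; have [sLN nsNL] := andP prL.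
have nLN : N \subset 'N(L).
  have [_ maxL] := maxgroupP mL.
  have prN := nilpotent_proper_norm nilN prL.
  apply: contraT => nsNN; case/andP: prN => _ /negP[].
  rewrite -{2}(maxL 'N_N(L)%G) //; last by rewrite subsetI sLN normG.
  rewrite /= properE subsetIl; apply: contra nsNN => /subset_trans-> //.
  exact: subsetIr.
have ntQ : N / L != 1 by rewrite -subG1 quotient_sub1.
have /andP[_ /negP[]] := sol_der1_proper (nilpotent_sol (quotient_nil L nilN)) (subxx _) ntQ.
rewrite derg1 -quotientR // quotientSK // -{1}defN.
by rewrite (normC (subset_trans sLN (der_norm 1 N))) mulgS.
Qed.

Lemma minnormal_sub_Socle (gT : finGroupType) (G M : {group gT}) :
  M <| G -> minnormal M G -> M \subset 'Soc(G).
Proof.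
move=> nsMG minM; rewrite /Socle bigprodGE sub_gen //.
by apply: (bigcup_sup M) => //; rewrite nsMG.
Qed.

(** Let Y complement Soc(G) :&: F(G). As F(G) is abelian, F(G) :&: Y is normal in G; a minimal
    normal subgroup inside it would lie in the socle and in Y, so it is trivial. *)
Lemma Fitting_sub_Socle (gT : finGroupType) (G : {group gT}) :
  'Phi(G) = 1 -> 'F(G) \subset 'Soc(G).
Proof.
move=> PhiG1.
have cFF := nilpotent_normal_abelian PhiG1 (Fitting_normal G) (Fitting_nil G).
have nsSG : 'Soc(G) :&: 'F(G) <| G by rewrite normalI ?Socle_normal ?Fitting_normal.
have cSS : abelian ('Soc(G) :&: 'F(G)) := abelianS (subsetIr _ _) cFF.
have [Y defG tiSY] := abelian_normal_compl nsSG cSS PhiG1.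
have sYG : Y \subset G by rewrite -defG mulG_subr.
have nsFYG : 'F(G) :&: Y <| G.
  rewrite /normal subIset ?Fitting_sub //= -{1}defG mulG_subG.
  rewrite (subset_trans (subsetIr _ _) (sub_abelian_norm cFF (subsetIl _ _))) /=.
  by rewrite normsI ?normG // (subset_trans sYG) ?gFnorm.
have FY1 : 'F(G) :&: Y = 1.
  apply/eqP; apply: contraT => ntFY.
  have [M minM sMFY] := minnormal_exists ntFY (normal_norm nsFYG).
  have [/andP[ntM nMG] _] := mingroupP minM.
  have nsMG : M <| G by rewrite /normal nMG (subset_trans sMFY) ?normal_sub.
  case/negP: ntM; rewrite -subG1 -tiSY -setIA subsetI sMFY.
  by rewrite minnormal_sub_Socle.
have: 'F(G) \subset ('Soc(G) :&: 'F(G)) * Y by rewrite defG Fitting_sub.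
move/setIidPr <-; rewrite -group_modl ?subsetIr // (setIC Y) FY1 mulg1.
exact: subsetIl.
Qed.

(** A Frattini H/K would be abelian. A minimal normal M either meets H trivially and centralises it,
    or lies in H; then M <= K, or M :&: K = 1 makes M abelian, hence M <= F(G) <= K again. So Soc(G)
    <= K C_G(H). *)
Lemma Frattini_free_over_Socle (gT : finGroupType) (G : {group gT}) :
  'Phi(G) = 1 -> Frattini_free_over G 'Soc(G) -> Frattini_free_over G 'F(G)%G.
Proof.
move=> PhiG1 FF; have nsFG := Fitting_normal G.
apply: (Frattini_free_over_descend nsFG (Socle_normal G) (Fitting_sub_Socle PhiG1) FF).
move=> K H chH sFK sHS.
have [nsKG nsHG /andP[sKH nsHK]] := chief_factor_normal chH.
apply: contra (nsHK) => FH.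
have abH := chief_factor_der1 chH nsKG (subxx K) nsHK FH.
have nsCG : 'C_G(H) <| G by rewrite norm_normalI // norms_cent ?normal_norm.
have sCHF : 'C_H(H) \subset K.
  apply: subset_trans sFK; apply: Fitting_max.
    exact: char_normal_trans (center_char H) nsHG.
  exact/abelian_nil/center_abelian.
have nKC : 'C_G(H) \subset 'N(K) := subset_trans (normal_sub nsCG) (normal_norm nsKG).
suff: H \subset K * 'C_G(H).
  move/setIidPl <-; rewrite setIC -group_modl // mul_subG //.
  by apply: subset_trans sCHF; rewrite setIC setIS ?subsetIr.
apply: subset_trans sHS _; rewrite -norm_joinEr // /Socle bigprodGE gen_subG.
apply/bigcupsP=> M /andP[nsMG minM].
have [/andP[ntM nMG] minM'] := mingroupP minM.
have min_cap (L : {group gT}) : L <| G -> M :&: L = 1 \/ M \subset L.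
  move=> nsLG; have [-> | ntI] := eqVneq (M :&: L) 1; [by left | right].
  rewrite -(minM' (M :&: L)%G) ?subsetIr ?subsetIl //=.
  by rewrite ntI normsI ?normal_norm.
have [tiMH | sMH] := min_cap H nsHG.
  apply: subset_trans (joing_subr _ _); rewrite subsetI normal_sub //.
  apply/commG1P/trivgP; rewrite -tiMH commg_subI // subsetI subxx.
    by rewrite (subset_trans (normal_sub nsMG)) ?normal_norm.
  by rewrite (subset_trans (normal_sub nsHG)).
apply: subset_trans (joing_subl _ _).
have [tiMK | //] := min_cap K nsKG.
apply: subset_trans sFK; apply: Fitting_max => //; apply: abelian_nil.
apply/commG1P/trivgP; rewrite -tiMK subsetI (der_sub 1 M) /=.
by apply: subset_trans abH; rewrite commgSS.
Qed.

(** * The condition on Frattini subgroups of quotients, and the cycle of implications *)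

(** Phi(G)N/N <= Phi(G/N) always holds; the converse is goodness tested at Phi(G)N. Conversely, (1)
    gives Phi(G/K) = 1 once Phi(G) <= K. *)
Lemma Frattini_free_over_PhiP (gT : finGroupType) (G : {group gT}) :
  Frattini_free_over G 'Phi(G)%G
  <-> (forall N : {group gT}, N <| G -> 'Phi(G / N) = ('Phi(G) * N) / N).
Proof.
split=> [FF N nsNG | PhiQ K H nsKG nsHG sPhiK].
  have nsPN : 'Phi(G) <*> N <| G := normalY (Phi_normal G) nsNG.
  have nNP : 'Phi(G) \subset 'N(N) := subset_trans (Phi_sub G) (normal_norm nsNG).
  rewrite -norm_joinEl //; apply/eqP; rewrite eqEsubset andbC.
  rewrite -(Frattini_over_quo nsNG nsPN); apply/andP; split.
    apply/Frattini_overP=> M mM sNM; rewrite join_subG sNM andbT.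
    exact: Phi_sub_max.
  have nsRG : coset N @*^-1 'Phi(G / N) <| G.
    by rewrite -{2}(quotientGK nsNG) cosetpre_normal Phi_normal.
  have FR : Frattini_over G N (coset N @*^-1 'Phi(G / N))%G.
    by rewrite Frattini_over_quo //= cosetpreK.
  rewrite -{1}(cosetpreK 'Phi(G / N)) quotientS //.
  apply: (FF ('Phi(G) <*> N)%G _ nsPN nsRG (joing_subl _ _)).
  exact: Frattini_overS (joing_subr _ _) (subxx _) FR.
rewrite Frattini_over_quo // PhiQ // mulSGid // trivg_quotient.
by rewrite quotient_sub1 // (subset_trans (normal_sub nsHG)) ?normal_norm.
Qed.

Theorem corollary1p2 (gT : finGroupType) (G : {group gT}) :
  [<-> forall N : {group gT}, N <| G -> 'Phi(G / N) = ('Phi(G) * N) / N;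
       no_Frattini_chief_factor (G / 'Phi(G));
       no_Frattini_chief_factor (G / 'F(G));
       no_Frattini_chief_factor (G / 'Fprime(G));
       forall H K : {group gT}, chief_factor G K H ->
         no_Frattini_chief_factor (G / 'C_G(H / K | 'Q))].
Proof.
have nsFG := Fitting_normal G; have nsPG := Phi_normal G.
have PhiQ1 : 'Phi(G / 'Phi(G)) = 1 := Phi_quotient_id G.
have sPF : 'Phi(G) \subset 'F(G) := Fitting_max nsPG (Phi_nilpotent G).
have sFqF : 'F(G) / 'Phi(G) \subset 'F(G / 'Phi(G)).
  by apply: Fitting_max; rewrite ?quotient_normal // quotient_nil // Fitting_nil.
have lift_Phi (B : {group coset_of 'Phi(G)}) (C : {group gT}) :
    coset 'Phi(G) @*^-1 B = C ->
  Frattini_free_over (G / 'Phi(G))%G B <-> Frattini_free_over G C.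
  move=> eqC; apply: iff_trans (Frattini_free_over_cosetpre B nsPG) _.
  by split; apply: Frattini_free_overS; rewrite /= eqC.
have FittingToPhi : Frattini_free_over (G / 'Phi(G))%G 'F(G / 'Phi(G))%G ->
    Frattini_free_over G 'Phi(G)%G.
  move=> FF; apply/(lift_Phi 1%G 'Phi(G)%G); first by rewrite /= -kerE ker_coset.
  apply: (Frattini_free_over1 PhiQ1 (Fitting_normal _) _ FF).
  exact: nilpotent_normal_abelian PhiQ1 (Fitting_normal _) (Fitting_nil _).
have nsCG (H K : {group gT}) : chief_factor G K H -> 'C_G(H / K | 'Q) <| G.
  exact: subcent_chief_factor_normal.
tfae.
- by move=> PhiQ; apply/(no_Frattini_chief_factor_quo nsPG)/Frattini_free_over_PhiP.
- move/(no_Frattini_chief_factor_quo nsPG)=> FF.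
  by apply/(no_Frattini_chief_factor_quo nsFG); apply: Frattini_free_overS FF.
- move/(no_Frattini_chief_factor_quo nsFG)=> FF.
  (* ['Fprime(G)] is declared as a plain set, so its group structure is supplied through the
     preimage that defines it. *)
  apply/(@no_Frattini_chief_factor_quo _ G (coset 'Phi(G) @*^-1 'Soc(G / 'Phi(G)))%G).
    exact: Fitting_prime_normal.
  apply: Frattini_free_overS FF; rewrite -sub_quotient_pre.
    exact: subset_trans sFqF (Fitting_sub_Socle PhiQ1).
  exact: subset_trans (Fitting_sub G) (normal_norm nsPG).
- move/(@no_Frattini_chief_factor_quo _ G (coset 'Phi(G) @*^-1 'Soc(G / 'Phi(G)))%G).
  move/(_ (Fitting_prime_normal G))=> FF H K chH.
  apply/(no_Frattini_chief_factor_quo (nsCG H K chH)).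
  apply: Frattini_free_overS (FittingToPhi _).
    exact: subset_trans sPF (Fitting_centralises_chief_factor chH).
  exact/(Frattini_free_over_Socle PhiQ1)/(Frattini_free_over_cosetpre _ nsPG).
move=> FC; apply/Frattini_free_over_PhiP/FittingToPhi.
apply: Frattini_free_overS sFqF _.
apply/(lift_Phi ('F(G) / 'Phi(G))%G 'F(G)%G).
  by rewrite quotientGK // (normalS sPF (Fitting_sub G)).
apply: Frattini_free_over_Fitting => U V chU.
exact/(no_Frattini_chief_factor_quo (nsCG U V chU))/FC.
Qed.
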